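(* Let $\delta\in\mathbb{N}$. For all $k,\ell\in\mathbb{N}_{>0}$: (1) $\mathrm{NBP}(\mathrm{ISA}_{k,\ell}),\ \oplus\mathrm{BP}(\mathrm{ISA}_{k,\ell})\le 3\cdot 2^{k+\ell/2}+2^\ell$; (2) $\mathrm{LNBP}_\delta(\mathrm{ISA}_{k,\ell})\le 12\cdot 2^k\max\{\frac{2^{\ell-\delta}}{\ell-\delta},\ell\}+\frac{2^{2\ell-\delta}}{\ell-\delta}$ if $\ell>\delta$, and $\mathrm{LNBP}_\delta(\mathrm{ISA}_{k,\ell})\le 2^k(3\ell+1)+2\cdot 2^\ell$ if $\ell\le\delta$; (3) $\mathrm{BP}(\mathrm{ISA}_{k,\ell})\le 9\cdot\frac{2^{k+\ell}}{\ell}+\frac{2^{2\ell}}{\ell}$; (4) $\mathrm{LNBF}_\delta(\mathrm{ISA}_{k,\ell})\le 12\cdot 2^k\cdot\max\{2^{\ell-\delta},\ell\}+3\cdot 2^\ell$; (5) $\mathrm{BF}(\mathrm{ISA}_{k,\ell})\le 7\cdot 2^k\cdot 2^\ell$.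
   Context: For $k,\ell\in\mathbb{N}_{>0}$, $\mathrm{ISA}_{k,\ell}\colon\{0,1\}^{k+2^k\ell+2^\ell}\to\{0,1\}$ (Indirect Storage Access) is defined as follows: on input $a$, let $\alpha$ be the number with big-endian binary representation $a_1\cdots a_k$, let $\beta$ be the number with big-endian binary representation given by the $\ell$ bits of $a$ starting at position $k+1+\ell\alpha$, and output the bit of $a$ at position $k+1+\ell 2^k+\beta$. A branching program (BP) on variable set $V$ is a tuple $(X,s,t_0,t_1,A_0,A_1,\mathrm{var})$: finite vertex set $X$, start vertex $s$, two distinct sinks $t_0,t_1$, arc sets $A_0,A_1\subseteq (X\setminus\{t_0,t_1\})\times(X\setminus\{s\})$ (arcs labelled $0$, resp. $1$), and $\mathrm{var}\colon X\setminus\{t_0,t_1\}\to V$. For $a\in\{0,1\}^V$ let $A[a]$ be the set of arcs $(u,v)\in A_c$ with $a_{\mathrm{var}(u)}=c$. As an NBP it computes $f(a)=1$ iff $(X,A[a])$ has a path from $s$ to $t_1$; as a parity BP ($\oplus$BP) it computes $f(a)=1$ iff the number of such paths is odd. It is deterministic if $(X,A_0\cup A_1)$ is acyclic and each of $A_0$, $A_1$ contains exactly one out-arc of every non-sink vertex. A $\delta$-limited nondeterministic BP ($\delta$-LNBP) for $f\colon\{0,1\}^V\to\{0,1\}$ is a deterministic BP computing some $f'\colon\{0,1\}^{V'}\to\{0,1\}$ with $V\subseteq V'$, $|V'\setminus V|=\delta$, such that $f(a)=\bigvee_{b\in\{0,1\}^{V'\setminus V}}f'(a,b)$. Size of a BP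 = number of non-sink vertices. $\mathrm{NBP}(f),\oplus\mathrm{BP}(f),\mathrm{LNBP}_\delta(f),\mathrm{BP}(f)$ are the minimum sizes of an NBP, $\oplus$BP, $\delta$-LNBP, deterministic BP computing $f$. A Boolean binary formula (BF) on $\{0,1\}^n$ is a rooted binary tree whose internal nodes each have exactly two children and are labelled by arbitrary functions $g\colon\{0,1\}^2\to\{0,1\}$, and whose leaves are labelled by one of $0,1,x_1,\dots,x_n,\neg x_1,\dots,\neg x_n$; it computes a function by composition. A $\delta$-limited nondeterministic binary formula ($\delta$-LNBF) on $\{0,1\}^n$ is a BF $\varphi'$ on $\{0,1\}^{n+\delta}$ and computes $f(a)=\bigvee_{b\in\{0,1\}^\delta}f_{\varphi'}(a,b)$. Size of a formula = number of leaves not labelled by a constant; $\mathrm{BF}(f)$, $\mathrm{LNBF}_\delta(f)$ are the minimum sizes of a BF, resp. $\delta$-LNBF, computing $f$. *)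

(* Defs.v *)
From mathcomp Require Import all_boot all_order all_algebra.
From mathcomp Require Import all_classical all_reals all_analysis.

Set Implicit Arguments.
Unset Strict Implicit.
Unset Printing Implicit Defensive.

Local Open Scope nat_scope.

(* Big-endian value of the word b 0, ..., b m.-1 (b 0 is most significant). *)
Definition be_val (m : nat) (b : nat -> bool) : nat :=
  \sum_(i < m) b i * 2 ^ (m - i.+1).

(* Positions count from 0 here: p stands for position p + 1 of a word indexed
   from 1.  The default value false is never used in ISA, see ISA_in_range. *)
Definition bit_at (n : nat) (a : {ffun 'I_n -> bool}) (p : nat) : bool :=
  oapp a false (insub p).

Definition ISA_len (k l : nat) : nat := k + 2 ^ k * l + 2 ^ l.

Definition ISA_alpha (k l : nat) (a : {ffun 'I_(ISA_len k l) -> bool}) : nat :=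
  be_val k (bit_at a).

Definition ISA_beta (k l : nat) (a : {ffun 'I_(ISA_len k l) -> bool}) : nat :=
  be_val l (fun i => bit_at a (k + l * ISA_alpha a + i)).

Definition ISA (k l : nat) (a : {ffun 'I_(ISA_len k l) -> bool}) : bool :=
  bit_at a (k + l * 2 ^ k + ISA_beta a).

Lemma be_val_lt (m : nat) (b : nat -> bool) : be_val m b < 2 ^ m.
Proof.
elim: m b => [|m IH] b; first by rewrite /be_val big_ord0.
rewrite /be_val big_ord_recl /= subn1 /= expnS mul2n -addnn -addnS leq_add //.
  by case: (b 0); rewrite ?mul1n.
exact: (IH (fun i => b i.+1)).
Qed.

Lemma ISA_in_range (k l : nat) (a : {ffun 'I_(ISA_len k l) -> bool}) :
  [/\ forall i, i < k -> i < ISA_len k l,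
      forall i, i < l -> k + l * ISA_alpha a + i < ISA_len k l &
      k + l * 2 ^ k + ISA_beta a < ISA_len k l].
Proof.
rewrite /ISA_len; split=> [i ik | i il |].
- by rewrite -addnA ltn_addr.
- apply: ltn_addr; rewrite -addnA ltn_add2l.
  apply: (@leq_trans (l * (ISA_alpha a).+1)); first by rewrite mulnS addnC ltn_add2r.
  by rewrite mulnC leq_mul2r be_val_lt orbT.
- by rewrite (mulnC l) ltn_add2l be_val_lt.
Qed.

Record bp (V : finType) := BP_mk {
  bp_X : finType;
  bp_s : bp_X;
  bp_t0 : bp_X;
  bp_t1 : bp_X;
  bp_arc : bool -> rel bp_X; (* bp_arc c is the arc set A_c *)
  bp_var : {x : bp_X | (x != bp_t0) && (x != bp_t1)} -> V;
  bp_t0_neq_t1 : bp_t0 != bp_t1;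
  bp_arcP : forall c u v,
    bp_arc c u v -> [&& u != bp_t0, u != bp_t1 & v != bp_s] }.

Definition bp_size (V : finType) (P : bp V) : nat :=
  #|[pred x : bp_X P | (x != bp_t0 P) && (x != bp_t1 P)]|.

(* The arc set A[a]. *)
Definition bp_active (V : finType) (P : bp V) (a : {ffun V -> bool}) :
    rel (bp_X P) :=
  fun u v =>
    if insub u is Some w then bp_arc (a (@bp_var V P w)) u v else false.

(* Paths repeat no vertex, so there are finitely many even if e has cycles, and
   the tail p of a path s :: p is shorter than #|X|. *)
Definition num_paths (X : finType) (e : rel X) (s t : X) : nat :=
  \sum_(n < #|X|)
    #|[set p : n.-tuple X | [&& path e s p, uniq (s :: p) & last s p == t]]|.

Definition nbp_fun (V : finType) (P : bp V) (a : {ffun V -> bool}) : bool :=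
  connect (bp_active (P := P) a) (bp_s P) (bp_t1 P).

Definition parity_bp_fun (V : finType) (P : bp V) (a : {ffun V -> bool}) : bool :=
  odd (num_paths (bp_active (P := P) a) (bp_s P) (bp_t1 P)).

Definition acyclic (X : finType) (e : rel X) : Prop :=
  forall p : seq X, cycle e p -> p = [::].

Definition bp_deterministic (V : finType) (P : bp V) : Prop :=
  acyclic (fun u v => bp_arc (b := P) false u v || bp_arc true u v) /\
  forall (c : bool) (u : bp_X P), u != bp_t0 P -> u != bp_t1 P ->
    exists! v, bp_arc c u v.

(* The assignment (a, b); V + 'I_delta is V together with delta new variables. *)
Definition join_assign (V : finType) (delta : nat)
    (a : {ffun V -> bool}) (b : {ffun 'I_delta -> bool}) :
    {ffun V + 'I_delta -> bool} :=
  [ffun x => match x with inl i => a i | inr j => b j end].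

Definition guess (V : finType) (delta : nat)
    (f' : {ffun V + 'I_delta -> bool} -> bool) (a : {ffun V -> bool}) : bool :=
  [exists b : {ffun 'I_delta -> bool}, f' (join_assign a b)].

Inductive bf (V : finType) : Type :=
| bf_const of bool
| bf_lit (neg : bool) (x : V) (* x if neg is false, its negation otherwise *)
| bf_node (g : bool -> bool -> bool) (phi psi : bf V).

Fixpoint bf_fun (V : finType) (phi : bf V) (a : {ffun V -> bool}) : bool :=
  match phi with
  | bf_const c => c
  | bf_lit neg x => neg (+) a x
  | bf_node g phi1 phi2 => g (bf_fun phi1 a) (bf_fun phi2 a)
  end.

Fixpoint bf_size (V : finType) (phi : bf V) : nat :=
  match phi with
  | bf_const _ => 0
  | bf_lit _ _ => 1
  | bf_node _ phi1 phi2 => bf_size phi1 + bf_size phi2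
  end.

(* The minimum of S, and +oo when S is empty. *)
Definition min_size {R : realType} (S : set nat) : \bar R :=
  match pselect (exists n, n \in S) with
  | left S_neq0 => ((ex_minn S_neq0)%:R%:E)%R
  | right _ => +oo%E
  end.

Section Measures.
Context {R : realType} (V : finType).
Implicit Type f : {ffun V -> bool} -> bool.

Definition NBP f : \bar R :=
  min_size [set n | exists P : bp V, nbp_fun P =1 f /\ bp_size P = n]%classic.

Definition parityBP f : \bar R :=
  min_size
    [set n | exists P : bp V, parity_bp_fun P =1 f /\ bp_size P = n]%classic.

Definition BP f : \bar R :=
  min_size [set n | exists P : bp V,
    [/\ bp_deterministic P, nbp_fun P =1 f & bp_size P = n]]%classic.

Definition LNBP (delta : nat) f : \bar R :=
  min_size [set n | exists P : bp (V + 'I_delta)%type,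
    [/\ bp_deterministic P, guess (nbp_fun P) =1 f & bp_size P = n]]%classic.

Definition BF f : \bar R :=
  min_size [set n | exists phi : bf V, bf_fun phi =1 f /\ bf_size phi = n]%classic.

Definition LNBF (delta : nat) f : \bar R :=
  min_size [set n | exists phi : bf (V + 'I_delta)%type,
    guess (bf_fun phi) =1 f /\ bf_size phi = n]%classic.

End Measures.

(* Main.v *)
(** Write a block of the address part as u v, with v its last bits.

    Nondeterministic and parity programs (v has floor(l/2) bits): read the
    address alpha and u, forget alpha, guess v and a data bit y_(uv) = 1, guess
    alpha again, and check v and alpha in a backward tree.  At most one path
    accepts, so both semantics agree.

    Deterministic programs: read alpha and u, forget alpha, read the table of
    the 2^j data bits whose index starts with u, forget u, and read alpha and v
    (j bits) to look up the table.  With 2^j between m/4 and m/2 both trees have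
    O(2^m/m) nodes per address, where m is the number of unguessed bits.  A
    guess of the leading delta bits of the block is verified right after reading
    alpha.  When delta >= l, the whole index is guessed and verified.

    Formulas: a multiplexer tree over the data bits whose selectors are the
    guessed bits and multiplexers over the address for the other block bits. *)

Require Import Defs.
From mathcomp Require Import all_boot all_order all_algebra.
From mathcomp Require Import all_classical all_reals all_analysis.
From mathcomp Require Import zify ring lra.

Set Implicit Arguments.
Unset Strict Implicit.
Unset Printing Implicit Defensive.

Local Open Scope nat_scope.

(** * Path counts in graphs whose arcs decrease the vertex number *)

Section DecreasingGraphs.
Variables (m : nat) (e : rel 'I_m).
Hypothesis e_decr : forall u v, e u v -> v < u.

Lemma decreasing_path_lt u v p : path e u (v :: p) -> last v p < u.
Proof.
elim: p u v => [|w p IH] u v /=; first by rewrite andbT; exact: e_decr.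
by case/and3P=> uv vw wp; apply: ltn_trans (e_decr uv); apply: IH; rewrite /= vw.
Qed.

Lemma decreasing_path_uniq u p : path e u p -> uniq (u :: p).
Proof.
elim: p u => [//|v p IH] u uvp; rewrite cons_uniq IH; last by case/andP: uvp.
rewrite andbT; apply/negP=> /splitPl u_in; case: u_in uvp => p1 p2 lastp1.
by rewrite -cat_cons cat_path => /andP[/decreasing_path_lt]; rewrite lastp1 ltnn.
Qed.

Lemma decreasing_acyclic : acyclic e.
Proof.
move=> [//|u [|v p]] /=; first by rewrite andbT => /e_decr; rewrite ltnn.
rewrite rcons_path => /and3P[uv vp] /e_decr.
have := @decreasing_path_lt u v p; rewrite /= uv vp => /(_ isT).
by move=> lt1 lt2; have := ltn_trans lt1 lt2; rewrite ltnn.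
Qed.

Variables (t : 'I_m) (F : 'I_m -> nat).
Hypothesis F_rec : forall u, F u = (u == t) + \sum_(v | e u v) F v.

Let npaths n u := #|[set p : n.-tuple 'I_m | path e u p && (last u p == t)]|.

Let npathsS n u : npaths n.+1 u = \sum_(v | e u v) npaths n v.
Proof.
rewrite /npaths; under eq_bigr do rewrite -sum1_card; rewrite -sum1_card.
rewrite pair_big_dep /=.
rewrite (reindex (fun p : 'I_m * n.-tuple 'I_m => [tuple of p.1 :: p.2])) /=.
  by apply: eq_bigl => -[v p]; rewrite !inE /= andbA.
exists (fun p => (thead p, [tuple of behead p])) => [[v p]|p] _ /=.
  by congr pair; apply: val_inj.
by rewrite -tuple_eta.
Qed.

(** A path from [u] has at most [u] arcs, so the lengths below [N] cover all of them; the empty path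
    and the choice of the first arc give the two terms of [F_rec]. *)
Let sum_npaths N (u : 'I_m) : u < N -> \sum_(n < N) npaths n u = F u.
Proof.
elim: N u => [//|N IH] u uN; rewrite big_ord_recl F_rec; congr addn.
  rewrite /npaths; case: eqP => [->|/eqP/negPf u_neq_t].
    rewrite (_ : finset _ = [set [tuple]]) ?cards1 //.
    by apply/setP=> p; rewrite !inE (tuple0 p) /= eqxx.
  by apply: eq_card0 => p; rewrite !inE (tuple0 p) /= u_neq_t.
rewrite (eq_bigr (fun i : 'I_N => \sum_(v | e u v) npaths i v)); last first.
  by move=> i _; exact: npathsS.
rewrite exchange_big /=; apply: eq_bigr => v /e_decr vu.
by apply: IH; apply: leq_trans vu _.
Qed.

(** Walks in a decreasing graph never repeat a vertex, so counting repetition-free paths is counting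
    walks, and these obey the recursion of [F]. *)
Lemma num_paths_decreasing s : num_paths e s t = F s.
Proof.
rewrite /num_paths -[RHS](@sum_npaths #|'I_m|); last by rewrite card_ord.
apply: eq_bigr => n _; apply: eq_card => p; rewrite !inE.
have [sp|//] /= := boolP (path e s p).
by have /= -> := decreasing_path_uniq sp.
Qed.

Lemma connect_decreasing s : connect e s t = (0 < F s).
Proof.
apply/idP/idP => [/connectP[p] | ].
  elim: p s => [|v p IH] s /=; first by move=> _ <-; rewrite F_rec eqxx.
  by case/andP=> sv /IH{}IH /IH Fv; rewrite F_rec (bigD1 v) //= addnCA ltn_addr.
have [N] := ubnP s; elim: N s => [//|N IH] s sN.
rewrite F_rec; have [->|_] /= := eqVneq s t; first by rewrite connect0.
rewrite add0n lt0n sum_nat_eq0 negb_forall => /existsP[v].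
rewrite negb_imply -lt0n => /andP[sv /IH vt].
by apply: connect_trans (connect1 sv) (vt _); apply: leq_trans (e_decr sv) _.
Qed.

End DecreasingGraphs.

(** * Branching programs as lists of path-counting functions *)

Section Programs.
Variable V : finType.
Local Notation assign := {ffun V -> bool}.

Section ProgBP.
Variables (n : nat) (x : nat -> V) (arc : bool -> rel nat).

(** Vertices 0 and 1 are the sinks and the largest number is the start. [A] keeps only decreasing
    arcs that leave non-sinks, which makes the graph acyclic for any [arc]. *)
Let X := 'I_n.+2.
Let t0 : X := ord0.
Let t1 : X := @Ordinal n.+2 1 isT.
Let A c : rel X := fun u v => [&& 1 < u, v < u & arc c u v].

Let t0_neq_t1 : t0 != t1. Proof. by []. Qed.

Let AP c u v : A c u v -> [&& u != t0, u != t1 & v != ord_max].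
Proof.
case/and3P=> u_gt1 vu _; rewrite -!val_eqE /=.
rewrite (gtn_eqF u_gt1) (gtn_eqF (ltnW u_gt1)) /=.
by rewrite ltn_eqF //; apply: leq_trans vu _; rewrite -ltnS.
Qed.

Definition prog_bp : bp V :=
  BP_mk (fun w : {u : X | (u != t0) && (u != t1)} => x (val w)) t0_neq_t1 AP.

Lemma prog_bp_size : bp_size prog_bp = n.
Proof.
have inj2 : injective (fun i : 'I_n => lift ord0 (lift ord0 i)).
  by move=> i j /lift_inj/lift_inj.
rewrite /bp_size -[RHS](card_ord n) -(card_imset _ inj2) /=.
apply: eq_card => u; rewrite inE /=; apply/andP/imsetP => [[u0 u1]|[i _ ->] //].
have u_gt1 : 1 < u by move: u0 u1; rewrite -!val_eqE /=; lia.
have u2 : u.-2 < n by move: (ltn_ord u); lia.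
by exists (Ordinal u2) => //; apply: val_inj; rewrite /= /bump /=; lia.
Qed.

Lemma prog_bp_active a u v :
  @bp_active V prog_bp a u v = [&& 1 < u, v < u & arc (a (x u)) u v].
Proof.
rewrite /bp_active; case: insubP => [w _ <- //|].
rewrite negb_and !negbK => /orP[] /eqP -> //.
Qed.

Lemma prog_bp_deterministic :
  (forall c u, 1 < u < n.+2 -> exists2 v0, v0 < u & arc c u =1 pred1 v0) ->
  bp_deterministic prog_bp.
Proof.
move=> arc1; split=> [|c u u0 u1].
  by apply: decreasing_acyclic => u v /orP[] /and3P[].
have u_gt1 : 1 < u by move: u0 u1; rewrite -!val_eqE /=; lia.
have [|v0 v0u arcE] := arc1 c u; first by rewrite u_gt1 ltn_ord.
have v0n : v0 < n.+2 by apply: ltn_trans v0u (ltn_ord u).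
exists (Ordinal v0n); split=> [|v]; first by rewrite /= /A u_gt1 v0u arcE /=.
by case/and3P=> _ _; rewrite arcE => /eqP v_v0; apply: val_inj.
Qed.

Variable F : nat -> assign -> nat.
Hypotheses (F0 : forall a, F 0 a = 0) (F1 : forall a, F 1 a = 1).
Hypothesis F_rec : forall a u, 1 < u < n.+2 ->
  F u a = \sum_(v < u | arc (a (x u)) u v) F v a.

Let F_active a (u : X) :
  F u a = (u == t1) + \sum_(v | @bp_active V prog_bp a u v) F (v : X) a.
Proof.
under eq_bigl do rewrite prog_bp_active.
have [u_gt1|u_le1] := ltnP 1 u.
  rewrite F_rec ?u_gt1 ?ltn_ord // -val_eqE /= (gtn_eqF u_gt1) add0n.
  rewrite (big_ord_widen_cond n.+2 (arc (a (x u)) u) (fun v => F v a)); last first.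
    exact: ltnW.
  by apply: eq_bigl => v; rewrite andbC.
rewrite big_pred0 // addn0 -val_eqE /=.
by case: (val u) u_le1 => [|[|i]].
Qed.

Let active_decr a u v : @bp_active V prog_bp a u v -> v < u.
Proof. by rewrite prog_bp_active => /and3P[]. Qed.

Lemma nbp_fun_prog_bp a : nbp_fun prog_bp a = (0 < F n.+1 a).
Proof.
by rewrite /nbp_fun (connect_decreasing (@active_decr a) (F_active a)).
Qed.

Lemma parity_bp_fun_prog_bp a : parity_bp_fun prog_bp a = odd (F n.+1 a).
Proof.
by rewrite /parity_bp_fun (num_paths_decreasing (@active_decr a) (F_active a)).
Qed.

End ProgBP.

(* A program is a list of functions, the last vertex first: entry v of [L] is
   the number of accepting paths from vertex v, where vertices 0 and 1 are the
   sinks t0 and t1. *)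
Fixpoint entry (L : seq (assign -> nat)) (v : nat) : assign -> nat :=
  if L is f :: L' then if v == (size L').+2 then f else entry L' v
  else fun=> v == 1.

(* [g] can be the sum of the path counts over the c-successors of a new vertex;
   with [det], there is only one successor. *)
Definition reachable (det : bool) L (g : assign -> nat) :=
  exists r : pred nat,
    (det -> exists2 v0, v0 < (size L).+2 & r =1 pred1 v0) /\
    g =1 (fun a => \sum_(v < (size L).+2 | r v) entry L v a).

Inductive program (det : bool) : seq (assign -> nat) -> Prop :=
| program_nil : program det [::]
| program_cons L x (f : assign -> nat) (g : bool -> assign -> nat) : program det L ->
    (forall c : bool, reachable det L (g c)) -> (forall a, f a = g (a x) a) ->
    program det (f :: L).

Lemma entry_cat M L v : v < (size L).+2 -> entry (M ++ L) v = entry L v.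
Proof.
move=> vL; elim: M => [//|f M IH] /=; rewrite ltn_eqF ?IH //.
by apply: leq_trans vL _; rewrite size_cat; lia.
Qed.

Lemma entry0 L a : entry L 0 a = 0. Proof. by elim: L. Qed.
Lemma entry1 L a : entry L 1 a = 1. Proof. by elim: L. Qed.

Lemma eq_reachable det L g h : g =1 h -> reachable det L g -> reachable det L h.
Proof. by move=> gh [r [rdet rg]]; exists r; split=> // a; rewrite -gh rg. Qed.

Lemma reachable_entry det L v : v < (size L).+2 -> reachable det L (entry L v).
Proof.
move=> vL; exists (pred1 v); split=> [_|a]; first by exists v.
by rewrite (big_pred1 (Ordinal vL)).
Qed.

Lemma reachable_bool det L (b : bool) : reachable det L (fun=> b).
Proof.
apply: eq_reachable (@reachable_entry det L b _); last by case: b.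
by move=> a; case: b; rewrite ?entry0 ?entry1.
Qed.

Lemma reachable_head det f L : reachable det (f :: L) f.
Proof.
by apply: eq_reachable (@reachable_entry _ _ (size L).+2 _) => //= a; rewrite eqxx.
Qed.

Lemma reachable_cat det M L g : reachable det L g -> reachable det (M ++ L) g.
Proof.
(* [r] may hold of numbers beyond [L], which denote vertices of [M] in the longer list; the new
   conjunct removes them. *)
case=> r [rdet rg]; exists (fun v => r v && (v < (size L).+2)); split=> [|a].
  move/rdet=> [v0 v0L rE]; exists v0.
    by apply: leq_trans v0L _; rewrite size_cat; lia.
  by move=> v; rewrite /= rE /=; case: eqP => // ->.
rewrite rg (eq_bigr (fun v : 'I_ _ => entry (M ++ L) v a)); last first.
  by move=> v _; rewrite entry_cat.
rewrite (big_ord_widen_cond (size (M ++ L)).+2 r (fun v => entry (M ++ L) v a)) //.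
by rewrite size_cat; lia.
Qed.

(* If the sum is at most 1, a vertex counted twice has no accepting path. *)
Lemma reachableD L g h : (forall a, g a + h a <= 1) ->
  reachable false L g -> reachable false L h -> reachable false L (fun a => g a + h a).
Proof.
move=> gh1 [r [_ rg]] [r' [_ rh]]; exists (predU r r'); split=> // a.
pose S (p : pred nat) := \sum_(v < (size L).+2 | p v) entry L v a.
have SU : S r + S r' = S (predU r r') + S (predI r r').
  rewrite /S [in LHS]big_mkcond [X in _ + X = _]big_mkcond -big_split /=.
  rewrite [X in _ = X + _]big_mkcond [X in _ = _ + X]big_mkcond -big_split /=.
  by apply: eq_bigr => v _; case: (r v); case: (r' v); rewrite //= addnC.
have le_r : S (predI r r') <= S r.
  rewrite /S big_mkcond [leqRHS]big_mkcond; apply: leq_sum => v _ /=.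
  by case: (r v); case: (r' v).
have le_r' : S (predI r r') <= S r'.
  rewrite /S big_mkcond [leqRHS]big_mkcond; apply: leq_sum => v _ /=.
  by case: (r v); case: (r' v).
(* [S (predI r r')] is at most each of two summands whose total is at most 1, so it is 0 and [SU]
   becomes the claim. *)
by have := gh1 a; rewrite rg rh -/(S r) -/(S r') -/(S (predU r r')); lia.
Qed.

Lemma reachable_sum (I : eqType) (s : seq I) (G : I -> assign -> nat) L :
  (forall a, \sum_(i <- s) G i a <= 1) ->
  (forall i, i \in s -> reachable false L (G i)) ->
  reachable false L (fun a => \sum_(i <- s) G i a).
Proof.
elim: s => [|i s IH] G1 GL.
  apply: eq_reachable (reachable_bool _ _ false) => a.
  by rewrite big_nil.
apply: (@eq_reachable _ _ (fun a => G i a + \sum_(j <- s) G j a)).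
  by move=> a; rewrite big_cons.
apply: reachableD => [a||]; first by have := G1 a; rewrite big_cons.
  by apply: GL; rewrite mem_head.
apply: IH => [a|j js]; first by have := G1 a; rewrite big_cons; lia.
by apply: GL; rewrite in_cons js orbT.
Qed.

(** Vertices are numbered from the end of the list, so a new head gets number [(size L).+2] and all
    earlier arcs stay as they are. [x0] labels the numbers that denote no inner vertex. *)
Lemma program_arcs (x0 : V) det L : program det L ->
  exists (x : nat -> V) (arc : bool -> rel nat),
    (forall a u, 1 < u < (size L).+2 ->
       entry L u a = \sum_(v < u | arc (a (x u)) u v) entry L v a) /\
    (det -> forall c u, 1 < u < (size L).+2 ->
       exists2 v0, v0 < u & arc c u =1 pred1 v0).
Proof.
elim=> [|{}L y f g _ [x [arc [arcE arcdet]]] gL fg].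
  by exists (fun=> x0), (fun _ _ _ => false); split=> [a|_ c] [|[|u]].
have [r0 [r0det r0E]] := gL false; have [r1 [r1det r1E]] := gL true.
exists (fun u => if u == (size L).+2 then y else x u).
exists (fun c u v =>
  if u == (size L).+2 then (if c then r1 else r0) v else arc c u v).
split=> [a u /andP[u_gt1]|d c u /andP[u_gt1]] /=; rewrite ltnS leq_eqVlt.
  have [->|u_neq] /= := eqVneq u (size L).+2.
    move=> _; rewrite fg; under eq_bigr => v _ do rewrite (ltn_eqF (ltn_ord v)).
    by case: (a y); [rewrite r1E | rewrite r0E].
  move=> uL; rewrite arcE ?u_gt1 //; apply: eq_bigr => v _.
  by rewrite ltn_eqF // (ltn_trans (ltn_ord v)).
have [-> _|u_neq /= uL] := eqVneq u (size L).+2.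
  by case: c; [apply: r1det | apply: r0det].
by apply: arcdet; rewrite ?u_gt1.
Qed.

Theorem program_bp det f L : program det (f :: L) ->
  exists P : bp V, [/\ det -> bp_deterministic P,
    nbp_fun P =1 (fun a => 0 < f a), parity_bp_fun P =1 (fun a => odd (f a)) &
    bp_size P = (size L).+1].
Proof.
(* A nonempty program queries some variable, so [V] is inhabited. *)
move=> fL; have [x0 _] : exists x0 : V, True by inversion fL; exists x.
have [x [arc [arcE arcdet]]] := program_arcs x0 fL.
have F0 := entry0 (f :: L); have F1 := entry1 (f :: L).
exists (prog_bp (size L).+1 x arc); split.
- by move=> d; apply: prog_bp_deterministic; exact: arcdet.
- by move=> a; rewrite (nbp_fun_prog_bp F0 F1 arcE) /= eqxx.
- by move=> a; rewrite (parity_bp_fun_prog_bp F0 F1 arcE) /= eqxx.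
- exact: prog_bp_size.
Qed.

(** Prepending keeps vertex numbers, so whatever is reachable over [L] stays reachable over [L'];
    [n] is an upper bound on the number of new vertices. *)
Definition extends (det : bool) L n L' :=
  [/\ exists M, L' = M ++ L, size L' <= n + size L & program det L'].

Lemma extends_refl det L : program det L -> extends det L 0 L.
Proof. by split=> //; exists [::]. Qed.

Lemma extends_trans det L1 L2 L3 n1 n2 :
  extends det L1 n1 L2 -> extends det L2 n2 L3 -> extends det L1 (n2 + n1) L3.
Proof.
case=> [[M1 ->] s1 _] [[M2 ->] s2 pL3]; split=> //; last by move: s1 s2; lia.
by exists (M2 ++ M1); rewrite catA.
Qed.

Lemma extends_leq det L n1 n2 L' :
  n1 <= n2 -> extends det L n1 L' -> extends det L n2 L'.
Proof. by move=> n12 [ML sL pL]; split=> //; apply: leq_trans sL _; lia. Qed.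

Lemma eq_extends_head det L n (f g : assign -> nat) L' :
  f =1 g -> extends det L n (f :: L') -> extends det L n (g :: L').
Proof. by move=> /funext ->. Qed.

Lemma reachable_extends det L n L' g :
  extends det L n L' -> reachable det L g -> reachable det L' g.
Proof. by case=> [[M ->] _ _]; apply: reachable_cat. Qed.

Lemma extends_vertex det L x (f : assign -> nat) (g : bool -> assign -> nat) :
  program det L -> (forall c, reachable det L (g c)) ->
  (forall a, f a = g (a x) a) ->
  exists2 L', extends det L 1 L' & reachable det L' f.
Proof.
move=> pL gL fg; exists (f :: L); last exact: reachable_head.
split=> //; first by exists [:: f].
exact: program_cons fg.
Qed.

(** The branch that [a] takes in a complete decision tree of depth [m], where [q w] is the variable
    queried after the answers [w]. *)
Fixpoint answers m (q : seq bool -> V) (a : assign) : seq bool :=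
  if m is m'.+1 then
    let c := a (q [::]) in c :: answers m' (fun w => q (c :: w)) a
  else [::].

Lemma answersP m q (a : assign) w : size w = m ->
  (forall i, i < m -> nth false w i = a (q (take i w))) -> answers m q a = w.
Proof.
elim: m q w => [|m IH] q [|c w] //= [sw] wE.
have /= <- := wE 0 isT; rewrite (IH _ w) // => i im.
by have /= -> := wE i.+1 im.
Qed.

(** The two subtrees are built one after the other and joined by a root. Positive depth makes the
    root a vertex of its own, which stands at the head of the list and can serve as start vertex. *)
Lemma decision_tree_head det m q (leaf : seq bool -> assign -> nat) L :
  program det L -> (forall w, size w = m.+1 -> reachable det L (leaf w)) ->
  exists L', extends det L (2 ^ m.+1).-1 ((fun a => leaf (answers m.+1 q a) a) :: L').
Proof.
elim: m q leaf L => [|m IH] q leaf L pL leafL.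
  exists L; split; [by exists [:: fun a => leaf (answers 1 q a) a] | by [] | ].
  by apply: (@program_cons _ _ (q [::]) _ (fun c => leaf [:: c])) => // c; apply: leafL.
have [|L0 e0] := IH (fun w => q (false :: w)) (fun w => leaf (false :: w)) L pL.
  by move=> w sw; apply: leafL; rewrite /= sw.
case: (e0) => _ _ p0.
have [|L1 e1] := IH (fun w => q (true :: w)) (fun w => leaf (true :: w)) _ p0.
  by move=> w sw; apply: reachable_extends e0 _; apply: leafL; rewrite /= sw.
pose tree_at c (a : assign) :=
  leaf (c :: answers m.+1 (fun w => q (c :: w)) a) a.
case: (e1) => _ _ p1; set L2 := _ :: L1 in e1 p1.
have e2 := extends_trans e0 e1.
exists L2; case: e2 => [[M L2E] s2 _]; split.
- by exists ((fun a => leaf (answers m.+2 q a) a) :: M); rewrite L2E.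
- have : 0 < 2 ^ m.+1 by rewrite expn_gt0.
  by move: s2; rewrite /= (expnS 2 m.+1); lia.
apply: (@program_cons _ _ (q [::]) _ tree_at) => //.
  by case; [apply: reachable_head | apply: reachable_extends e1 (reachable_head _ _ _)].
Qed.

Lemma decision_tree det m q (leaf : seq bool -> assign -> nat) L :
  program det L -> (forall w, size w = m -> reachable det L (leaf w)) ->
  exists2 L', extends det L (2 ^ m).-1 L' &
    reachable det L' (fun a => leaf (answers m q a) a).
Proof.
case: m => [|m] pL leafL.
  by exists L; [exact: extends_refl | exact: leafL].
have [L' e'] := decision_tree_head q pL leafL.
by eexists; [exact: e' | exact: reachable_head].
Qed.

(** The members are added one after another, so the premise must hold over every extension [L'] of
    [L]. *)
Lemma extends_family (det : bool) (I : eqType) (s : seq I) (F : I -> assign -> nat)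
    c L : program det L ->
  (forall i L', i \in s -> program det L' -> (exists n, extends det L n L') ->
     exists2 L'', extends det L' c L'' & reachable det L'' (F i)) ->
  exists2 L', extends det L (size s * c) L' &
    forall i, i \in s -> reachable det L' (F i).
Proof.
move=> pL; elim: s => [|i s IH] Fs; first by exists L => //; exact: extends_refl.
have [j L' js|L1 e1 r1] := IH; first by apply: Fs; rewrite in_cons js orbT.
case: (e1) => _ _ p1.
have [||L2 e2 r2] := Fs i L1 _ p1; [by rewrite mem_head | by eexists; exact: e1 | ].
exists L2; first by rewrite mulSn; apply: extends_trans e1 e2.
move=> j; rewrite in_cons => /predU1P[-> //|/r1].
exact: reachable_extends e2.
Qed.

End Programs.

(** * Bit words and their binary values *)

Definition words m : seq (seq bool) := [seq val t | t : m.-tuple bool].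

Lemma size_words m : size (words m) = 2 ^ m.
Proof. by rewrite size_map -cardE card_tuple card_bool. Qed.

Lemma mem_words m w : (w \in words m) = (size w == m).
Proof.
apply/mapP/eqP => [[t _ ->]|sw]; first exact: size_tuple.
exists (tcast sw (in_tuple w)); first by rewrite mem_enum.
by rewrite /= val_tcast.
Qed.

Lemma words_uniq m : uniq (words m).
Proof. by rewrite map_inj_uniq ?enum_uniq //; exact: val_inj. Qed.

Lemma eq_be_val m b1 b2 : (forall i, i < m -> b1 i = b2 i) -> be_val m b1 = be_val m b2.
Proof. by move=> b12; apply: eq_bigr => i _; rewrite b12. Qed.

Lemma be_valD m n b :
  be_val (m + n) b = be_val m b * 2 ^ n + be_val n (fun i => b (m + i)).
Proof.
rewrite /be_val big_split_ord /= big_distrl /=; congr addn; apply: eq_bigr => i _.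
  by rewrite -mulnA -expnD -addnBAC.
by rewrite -addnS subnDl.
Qed.

Definition num (w : seq bool) := be_val (size w) (nth false w).

Lemma num_lt w : num w < 2 ^ size w. Proof. exact: be_val_lt. Qed.

Lemma num_mkseq b m : num (mkseq b m) = be_val m b.
Proof. by rewrite /num size_mkseq; apply: eq_be_val => i im; rewrite nth_mkseq. Qed.

Lemma num_cat u v : num (u ++ v) = num u * 2 ^ size v + num v.
Proof.
rewrite /num size_cat be_valD; congr (_ * _ + _); apply: eq_be_val => i im.
  by rewrite nth_cat im.
by rewrite nth_cat ltnNge leq_addr addKn.
Qed.

Lemma mkseqD (T : Type) (f : nat -> T) m n :
  mkseq f (m + n) = mkseq f m ++ mkseq (fun i => f (m + i)) n.
Proof. by rewrite /mkseq iotaD map_cat (addnC 0) iotaDl -map_comp. Qed.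

(** * Programs that read an indirect storage *)

Section Storage.
(** [X] sends input positions to variables, so that the same constructions serve with and without
    guess variables in [V]. *)
Variables (V : finType) (X : nat -> V) (k l : nat).
Local Notation assign := {ffun V -> bool}.
Implicit Types (A : assign) (u v w : seq bool).

Definition address A := mkseq (fun i => A (X i)) k.
Definition block_pos w i := k + l * num w + i.
Definition block A o n := mkseq (fun i => A (X (block_pos (address A) (o + i)))) n.
Definition data_pos w := k + l * 2 ^ k + num w.

Lemma blockD A o m n : block A o (m + n) = block A o m ++ block A (o + m) n.
Proof.
by rewrite /block mkseqD; congr cat; apply: eq_map => i; rewrite addnA.
Qed.

Lemma ISA_storage A (a : {ffun 'I_(ISA_len k l) -> bool}) :
  (forall p, p < ISA_len k l -> A (X p) = bit_at a p) ->
  A (X (data_pos (block A 0 l))) = ISA a.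
Proof.
have [addr_lt block_lt data_lt] := ISA_in_range a.
move=> AX; have addrE : num (address A) = ISA_alpha a.
  by rewrite num_mkseq; apply: eq_be_val => i /addr_lt; exact: AX.
have blockE : num (block A 0 l) = ISA_beta a.
  rewrite num_mkseq; apply: eq_be_val => i /block_lt il.
  by rewrite /block_pos addrE; exact: AX.
by rewrite /ISA /data_pos blockE; exact: AX.
Qed.

Lemma answers_mkseq n (Y : nat -> V) A :
  answers n (fun w => Y (size w)) A = mkseq (fun i => A (Y i)) n.
Proof.
apply: answersP => [|i i_n]; first by rewrite size_mkseq.
by rewrite nth_mkseq // size_take size_mkseq i_n.
Qed.

(** The query order of a tree that reads the address and then the selected block from offset [o] on:
    after [k] answers the address is [take k w]. *)
Definition storage_query o w :=
  X (if size w < k then size w else block_pos (take k w) (o + (size w - k))).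

Lemma storage_queryE o n A i : i < k + n ->
  nth false (address A ++ block A o n) i =
  A (storage_query o (take i (address A ++ block A o n))).
Proof.
move=> i_kn; have s_addr : size (address A) = k by rewrite size_mkseq.
rewrite /storage_query size_take size_cat s_addr size_mkseq i_kn nth_cat s_addr.
have [i_k|k_i] := ltnP i k; first by rewrite nth_mkseq.
by rewrite take_takel // take_size_cat // nth_mkseq //; lia.
Qed.

Lemma answers_storage o n A :
  answers (k + n) (storage_query o) A = address A ++ block A o n.
Proof.
apply: answersP; first by rewrite size_cat !size_mkseq.
by move=> i; exact: storage_queryE.
Qed.

Variable det : bool.

Definition lookup o j (g : seq bool) A : nat := nth false g (num (block A o j)).

(** One tree for each of the [2 ^ 2 ^ j] possible tables [g]: it reads the address and [j] block
    bits and ends in constants, that is, in sinks. *)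
Lemma extends_lookups o j (L : seq (assign -> nat)) : program det L ->
  exists2 L', extends det L (2 ^ 2 ^ j * (2 ^ (k + j)).-1) L' &
    forall g, g \in words (2 ^ j) -> reachable det L' (lookup o j g).
Proof.
move=> pL; rewrite -(size_words (2 ^ j)); apply: extends_family => // g L' _ pL' _.
have [|L'' e'' r''] := @decision_tree _ det (k + j) (storage_query o)
  (fun w _ => nth false g (num (drop k w))) L' pL'.
  by move=> w _; apply: reachable_bool.
exists L'' => //; apply: eq_reachable r'' => A.
by rewrite answers_storage drop_size_cat // size_mkseq.
Qed.

(* Once the prefix [w] of the block is known, the [2 ^ j] data bits that it
   leaves open are read as a table; the address may then be forgotten, since the
   program for the table reads the address again. *)
Lemma extends_data n j (L : seq (assign -> nat)) : program det L ->
  exists2 L', extends det L (2 ^ n * (2 ^ 2 ^ j).-1 + 2 ^ 2 ^ j * (2 ^ (k + j)).-1) L' &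
    forall w, w \in words n ->
      reachable det L' (fun A => A (X (data_pos (w ++ block A n j)))).
Proof.
move=> pL; have [L1 e1 r1] := extends_lookups n j pL.
have [_ _ pL1] := e1.
have [w L2|L2 e2 r2] := @extends_family _ det _ (words n)
  (fun w A => A (X (data_pos (w ++ block A n j)))) (2 ^ 2 ^ j).-1 L1 pL1; last first.
  by exists L2 => //; rewrite -(size_words n); exact: extends_trans e1 e2.
rewrite mem_words => /eqP sw pL2 [n2 e2].
(* The data positions with prefix [w] are [2 ^ j] consecutive ones, starting at [num w * 2 ^ j] in
   the data part; the answers read there form the table. *)
have [|L3 e3 r3] := @decision_tree _ det (2 ^ j)
  (fun g => X (k + l * 2 ^ k + num w * 2 ^ j + size g)) (lookup n j) L2 pL2.
  move=> g sg; apply: reachable_extends e2 _; apply: r1; rewrite mem_words sg //.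
exists L3 => //; apply: eq_reachable r3 => A.
rewrite (answers_mkseq _ (fun i => X (k + l * 2 ^ k + num w * 2 ^ j + i))).
have szb : size (block A n j) = j by rewrite size_mkseq.
rewrite /lookup nth_mkseq; last by rewrite -{2}szb num_lt.
by rewrite /data_pos num_cat szb addnA.
Qed.

Variable B : nat -> V.

Definition guessed A d := mkseq (fun i => A (B i)) d.

(** The first [d] block bits come from the guess: for each [u], a tree over the guess leads to the
    data program of the full prefix [w ++ u]. *)
Lemma extends_guessed_data d n j (L : seq (assign -> nat)) : program det L ->
  exists2 L', extends det L (2 ^ n * (2 ^ d).-1 +
    (2 ^ (d + n) * (2 ^ 2 ^ j).-1 + 2 ^ 2 ^ j * (2 ^ (k + j)).-1)) L' &
    forall u, u \in words n -> reachable det L'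
      (fun A => A (X (data_pos (guessed A d ++ u ++ block A (d + n) j)))).
Proof.
move=> pL; have [L1 e1 r1] := extends_data (d + n) j pL.
have [_ _ pL1] := e1.
have [u L2|L2 e2 r2] := @extends_family _ det _ (words n)
  (fun u A => A (X (data_pos (guessed A d ++ u ++ block A (d + n) j))))
  (2 ^ d).-1 L1 pL1; last first.
  by exists L2 => //; rewrite -(size_words n); exact: extends_trans e1 e2.
rewrite mem_words => /eqP su pL2 [n2 e2].
have [|L3 e3 r3] := @decision_tree _ det d (fun w => B (size w))
  (fun w A => A (X (data_pos ((w ++ u) ++ block A (d + n) j)))) L2 pL2.
  move=> w sw; apply: reachable_extends e2 _; apply: r1.
  by rewrite mem_words size_cat sw su.
exists L3 => //; apply: eq_reachable r3 => A.
by rewrite answers_mkseq catA.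
Qed.

(** Three vertices per bit: a tree of depth two compares the guessed bit with the block bit, and a
    mismatch leads to the rejecting sink. *)
Lemma extends_check d w (T : assign -> nat) (L : seq (assign -> nat)) :
  program det L -> reachable det L T ->
  exists2 L', extends det L (3 * d) L' & reachable det L'
    (fun A => (guessed A d == mkseq (fun i => A (X (block_pos w i))) d) * T A).
Proof.
move=> pL rT; elim: d => [|d [L1 e1 r1]].
  exists L; first exact: extends_refl.
  by apply: eq_reachable rT => A; rewrite eqxx mul1n.
have [_ _ pL1] := e1.
pose q (s : seq bool) := if s is [::] then B d else X (block_pos w d).
pose leaf (s : seq bool) A := if nth false s 0 == nth false s 1
  then (guessed A d == mkseq (fun i => A (X (block_pos w i))) d) * T A else 0.
have [s _|L2 e2 r2] := @decision_tree _ det 2 q leaf L1 pL1.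
  by rewrite /leaf; case: eqP => _ //; exact: (reachable_bool _ _ false).
exists L2; first by rewrite mulnSr addnC; exact: extends_trans e1 e2.
apply: eq_reachable r2 => A; rewrite /leaf /=.
rewrite /guessed !mkseqS eqseq_rcons.
by case: (A (B d) == _); rewrite ?andbT ?andbF.
Qed.

(** From the start: a tree over the address, then for each address the check of the guess and a tree
    over the next [n] block bits, ending in [G]. By [0 < k] the address tree has a root vertex. *)
Lemma program_storage d n (G : seq bool -> assign -> nat) (L : seq (assign -> nat)) :
  0 < k -> program det L -> (forall u, u \in words n -> reachable det L (G u)) ->
  exists L', extends det L ((2 ^ k).-1 + 2 ^ k * (3 * d + (2 ^ n).-1))
    ((fun A => (guessed A d == block A 0 d) * G (block A d n) A) :: L').
Proof.
move=> k_gt0 pL rG.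
pose F w A := (guessed A d == mkseq (fun i => A (X (block_pos w i))) d) *
   G (mkseq (fun i => A (X (block_pos w (d + i)))) n) A.
have [w L1 sw pL1 [n1 e1]|L1 e1 r1] := @extends_family _ det _ (words k) F
  (3 * d + (2 ^ n).-1) L pL.
  have [u su|L2 e2 r2] := @decision_tree _ det n
    (fun u => X (block_pos w (d + size u))) G L1 pL1.
    by apply: reachable_extends e1 _; apply: rG; rewrite mem_words su.
  have [_ _ pL2] := e2.
  have [L3 e3 r3] := extends_check d w pL2 r2.
  exists L3; first exact: extends_trans e2 e3.
  apply: eq_reachable r3 => A; congr (_ * _).
  by rewrite (answers_mkseq _ (fun i => X (block_pos w (d + i)))).
have [_ _ pL1] := e1.
have := @decision_tree_head _ det k.-1 (fun w => X (size w)) F L1 pL1.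
rewrite (prednK k_gt0) => -[w sw|L2 e2]; first by apply: r1; rewrite mem_words sw.
exists L2; rewrite -{2}(size_words k).
apply: eq_extends_head (extends_trans e1 e2) => A.
by rewrite answers_mkseq.
Qed.

(** A tree with arcs directed to its root: the vertex of [rcons w c] queries the bit that follows
    [w] and moves to the vertex of [w] if the bit is [c], else it rejects. The empty word is the
    accepting sink; levels 1 to [i] have [2 ^ i.+1 - 2] vertices in total. *)
Lemma extends_reverse_tree o n i (L : seq (assign -> nat)) : i <= k + n ->
  program false L ->
  exists2 L', extends false L (2 ^ i.+1).-2 L' & forall w, w \in words i ->
    reachable false L' (fun A => w == take i (address A ++ block A o n)).
Proof.
move=> i_kn pL; elim: i i_kn => [|i IH] i_kn.
  exists L => [|w]; first exact: extends_refl.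
  rewrite mem_words => /nilP ->; apply: eq_reachable (reachable_bool _ _ true) => A.
  by rewrite take0.
have [L1 e1 r1] := IH (ltnW i_kn); have [_ _ pL1] := e1.
have [w L2 sw pL2 [n2 e2]|L2 e2 r2] := @extends_family _ false _ (words i.+1)
  (fun w A => w == take i.+1 (address A ++ block A o n)) 1 L1 pL1; last first.
  exists L2 => //; apply: extends_leq (extends_trans e1 e2).
  rewrite size_words muln1 (expnS 2 i.+1) (expnS 2 i).
  have : 0 < 2 ^ i by rewrite expn_gt0.
  lia.
move: sw; rewrite mem_words; case/lastP: w => // w c.
rewrite size_rcons eqSS => /eqP sw.
pose g (b : bool) A : nat :=
  if b == c then (w == take i (address A ++ block A o n) : nat) else 0.
apply: (@extends_vertex _ _ _ (storage_query o w) _ g) => // [b|A].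
  rewrite /g; case: eqP => _; last exact: (reachable_bool _ _ false).
  by apply: reachable_extends e2 _; apply: r1; rewrite mem_words sw.
rewrite (take_nth false); last by rewrite size_cat !size_mkseq.
rewrite eqseq_rcons storage_queryE // /g.
case: (w =P _) => [<-|_] /=; last by case: ifP.
by rewrite eq_sym; case: (_ == c).
Qed.

Lemma sum_words_eq m v : size v = m -> forall F : seq bool -> nat,
  \sum_(w <- words m) (F w) * (w == v) = F v.
Proof.
move=> sv F; rewrite (bigD1_seq v) ?words_uniq ?mem_words ?sv //= eqxx muln1.
by rewrite big1 ?addn0 // => w /negPf ->; rewrite muln0.
Qed.

(** Three layers: a forward tree over the address and [p] block bits, one vertex for each of the
    [2 ^ (p + q)] indices to test its data bit, and a reverse tree that verifies the address and the
    last [q] block bits. *)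
Lemma program_unambiguous p q : 0 < k + p ->
  exists L', extends false [::] ((2 ^ (k + p)).-1 + (2 ^ (p + q) + (2 ^ (k + q).+1).-2))
    ((fun A => A (X (data_pos (block A 0 (p + q)))) : nat) :: L').
Proof.
move=> kp_gt0.
have [L1 e1 r1] := extends_reverse_tree p (leqnn (k + q)) (program_nil V false).
have [_ _ pL1] := e1.
pose Y t A : nat := A (X (data_pos t)) * (drop p t == block A p q).
have [t L2 st pL2 [n2 e2]|L2 e2 r2] := @extends_family _ false _ (words (p + q))
  Y 1 L1 pL1.
  have sumE A : \sum_(w <- words k) (w ++ drop p t == address A ++ block A p q) =
      (drop p t == block A p q).
    rewrite -(@sum_words_eq k (address A) _ (fun=> drop p t == block A p q)).
      apply: eq_big_seq => w; rewrite mem_words => /eqP sw.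
      by rewrite eqseq_cat ?size_mkseq // andbC mulnb.
    by rewrite size_mkseq.
  (* On data bit 1, arcs go to the reverse-tree vertices of all addresses [w]; only the true address
     can accept, so the sum is at most 1. *)
  pose g (b : bool) A := if b then
     \sum_(w <- words k) (w ++ drop p t == address A ++ block A p q) else 0.
  apply: (@extends_vertex _ _ _ (X (data_pos t)) _ g) => // [b|A]; last first.
    by rewrite /Y /g sumE; case: (A _); rewrite ?mul1n.
  case: b; last exact: (reachable_bool _ _ false).
  apply: reachable_sum => [A|w]; first by rewrite sumE; case: eqP.
  rewrite mem_words => /eqP sw; apply: reachable_extends e2 _.
  apply: eq_reachable (r1 (w ++ drop p t) _) => [A|].
    by rewrite take_oversize // size_cat !size_mkseq.
  by move: st; rewrite !mem_words size_cat size_drop sw => /eqP ->; lia.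
have [_ _ pL2] := e2.
(* The forward tree ends in arcs to the vertices of all continuations [v]; only the true last [q]
   bits can accept. *)
pose leaf w A := \sum_(v <- words q) Y (drop k w ++ v) A.
have leafE w A : size w = k + p -> leaf w A = A (X (data_pos (drop k w ++ block A p q))).
  move=> sw; rewrite -(@sum_words_eq q (block A p q) _
    (fun v => A (X (data_pos (drop k w ++ v))))) ?size_mkseq //.
  apply: eq_bigr => v _; rewrite /Y drop_size_cat // size_drop sw; lia.
have := @decision_tree_head _ false (k + p).-1 (storage_query 0) leaf L2 pL2.
rewrite prednK // => -[w sw|L3 e3].
  apply: reachable_sum => [A|v].
    by rewrite -/(leaf w A) leafE //; case: (A _).
  rewrite mem_words => /eqP sv; apply: r2.
  by rewrite mem_words size_cat size_drop sw sv; lia.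
exists L3; rewrite -(size_words (p + q)) -(muln1 (size _)).
apply: eq_extends_head (extends_trans (extends_trans e1 e2) e3) => A.
rewrite answers_storage -/(leaf _ A) leafE ?size_cat ?size_mkseq //.
by rewrite drop_size_cat ?size_mkseq // blockD.
Qed.


(** * Formulas that read an indirect storage *)

Fixpoint mux (s : seq (bf V)) (leaf : seq bool -> bf V) : bf V :=
  if s is phi :: s' then
    bf_node orb
      (bf_node andb phi (mux s' (fun w => leaf (true :: w))))
      (bf_node (fun b c => ~~ b && c) phi (mux s' (fun w => leaf (false :: w))))
  else leaf [::].

Lemma mux_fun s leaf A :
  bf_fun (mux s leaf) A = bf_fun (leaf [seq bf_fun phi A | phi <- s]) A.
Proof.
elim: s leaf => [//|phi s IH] leaf /=; rewrite !IH.
by case: (bf_fun phi A); rewrite /= ?orbF.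
Qed.

(** The selector at position [i] of [s], counted from 0, occurs [2 * 2 ^ i] times, and there are
    [2 ^ size s] leaves. *)
Lemma mux_size b c s leaf :
  all (fun phi => bf_size phi <= b) s -> (forall w, bf_size (leaf w) <= c) ->
  bf_size (mux s leaf) <= 2 * (2 ^ size s).-1 * b + 2 ^ size s * c.
Proof.
move=> sb leafc; elim: s sb leaf leafc => [|phi s IH] /= sb leaf leafc.
  by rewrite mul1n; apply: leq_trans (leafc _) _; rewrite leq_addl.
case/andP: sb => phib sb.
have IHt := IH sb (fun w => leaf (true :: w)) (fun w => leafc _).
have IHf := IH sb (fun w => leaf (false :: w)) (fun w => leafc _).
have p_gt0 : 0 < 2 ^ size s by rewrite expn_gt0.
move: IHt IHf p_gt0; rewrite expnS; set n := 2 ^ size s; case: n => [//|n] /= *.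
by nia.
Qed.

Definition block_bit i : bf V :=
  mux (mkseq (fun j => bf_lit false (X j)) k)
    (fun w => bf_lit false (X (block_pos w i))).

Lemma block_bit_fun i A : bf_fun (block_bit i) A = A (X (block_pos (address A) i)).
Proof. by rewrite mux_fun /= -map_comp. Qed.

Lemma block_bit_size i : bf_size (block_bit i) <= 3 * 2 ^ k - 2.
Proof.
apply: leq_trans (@mux_size 1 1 _ _ _ _) _ => //; last first.
  rewrite size_mkseq; have : 0 < 2 ^ k by rewrite expn_gt0.
  by lia.
by rewrite /mkseq all_map; apply/allP => j _.
Qed.

Fixpoint check_formula d : bf V :=
  if d is d'.+1 then
    bf_node andb (check_formula d')
      (bf_node eqb (bf_lit false (B d')) (block_bit d'))
  else bf_const V true.

Lemma check_formula_fun d A : bf_fun (check_formula d) A = (guessed A d == block A 0 d).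
Proof.
elim: d => [|d IH] /=; first by rewrite eqxx.
by rewrite IH /guessed /block !mkseqS eqseq_rcons block_bit_fun.
Qed.

Lemma check_formula_size d : bf_size (check_formula d) <= d * (3 * 2 ^ k - 1).
Proof.
elim: d => [//|d IH] /=; rewrite mulSn addnC; apply: leq_add => //.
have : 0 < 2 ^ k by rewrite expn_gt0.
by have := block_bit_size d; lia.
Qed.

(* The guessed bits are the innermost selectors, as these are repeated most
   often and are literals. *)
Definition storage_formula d n : bf V :=
  bf_node andb (check_formula d)
    (mux (mkseq (fun i => block_bit (d + i)) n) (fun u =>
       mux (mkseq (fun i => bf_lit false (B i)) d) (fun w =>
         bf_lit false (X (data_pos (w ++ u)))))).

Lemma storage_formula_fun d n A : bf_fun (storage_formula d n) A =
  (guessed A d == block A 0 d) && A (X (data_pos (block A 0 (d + n)))).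
Proof.
rewrite /= check_formula_fun; case: eqP => //= guess_ok.
rewrite !mux_fun /= -!map_comp blockD -guess_ok.
congr (A (X (data_pos (_ ++ _)))); apply: eq_map => i.
by rewrite /= block_bit_fun.
Qed.

Lemma storage_formula_size d n : bf_size (storage_formula d n) <=
  d * (3 * 2 ^ k - 1) + (6 * 2 ^ k * (2 ^ n).-1 + 2 ^ n * (3 * 2 ^ d - 2)).
Proof.
rewrite /=; apply: leq_add (check_formula_size d) _.
have d_gt0 : 0 < 2 ^ d by rewrite expn_gt0.
(* The outer selectors are block bits, rounded up to size [3 * 2 ^ k]; each outer leaf is a
   multiplexer over [d] literals, of size at most [2 * (2 ^ d - 1) + 2 ^ d]. *)
apply: leq_trans (@mux_size (3 * 2 ^ k) (3 * 2 ^ d - 2) _ _ _ _) _.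
- rewrite /mkseq all_map; apply/allP => j _ /=.
  by apply: leq_trans (block_bit_size _) (leq_subr _ _).
- move=> u; apply: leq_trans (@mux_size 1 1 _ _ _ _) _ => //.
    by rewrite /mkseq all_map; apply/allP => j _.
  by rewrite size_mkseq; lia.
by rewrite size_mkseq; lia.
Qed.

End Storage.

(** * Input variables and guess variables *)

Section StorageVariables.
Variables (k l d delta : nat).
Hypotheses (d_delta : d <= delta) (d_l : d <= l).

Let len_gt0 : 0 < ISA_len k l.
Proof. by rewrite /ISA_len addn_gt0 expn_gt0 orbT. Qed.

Definition storage_var p : 'I_(ISA_len k l) := insubd (Ordinal len_gt0) p.

Lemma storage_varE (a : {ffun 'I_(ISA_len k l) -> bool}) p :
  p < ISA_len k l -> a (storage_var p) = bit_at a p.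
Proof.
by move=> p_len; rewrite /storage_var /insubd /bit_at insubT.
Qed.

(** A total function on numbers; [d <= delta] keeps the indices [i < d] in the range where it yields
    guess variables. *)
Definition guess_var i : ('I_(ISA_len k l) + 'I_delta)%type :=
  if insub i is Some j then inr j else inl (storage_var 0).

(** An accepted assignment has the addressed data bit 1; conversely, the guess that copies the true
    block bits passes the comparison. *)
Lemma guess_storage (f : {ffun 'I_(ISA_len k l) + 'I_delta -> bool} -> bool) :
  (forall A, f A = (guessed guess_var A d == block (inl \o storage_var) k l A 0 d)
    && A (inl (storage_var (data_pos k l (block (inl \o storage_var) k l A 0 l))))) ->
  guess f =1 @ISA k l.
Proof.
move=> fE a; have storeE (b : {ffun 'I_delta -> bool}) p : p < ISA_len k l ->
    join_assign a b ((inl \o storage_var) p) = bit_at a p.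
  by move=> p_len; rewrite ffunE /= storage_varE.
apply/existsP/idP => [[b]|ISAa].
  by rewrite fE => /andP[_]; rewrite (ISA_storage (storeE b)).
(* The block does not depend on the guess variables, so it can be read under the dummy guess [b0] in
   order to define the guess [b]. *)
pose b0 : {ffun 'I_delta -> bool} := [ffun=> false].
pose b : {ffun 'I_delta -> bool} :=
  [ffun i : 'I_delta => nth false (block (inl \o storage_var) k l (join_assign a b0) 0 l) i].
exists b; rewrite fE (ISA_storage (storeE b)) ISAa andbT.
have blockE (A A' : {ffun 'I_(ISA_len k l) + 'I_delta -> bool}) n :
    (forall v, A (inl v) = A' (inl v)) ->
    block (inl \o storage_var) k l A 0 n = block (inl \o storage_var) k l A' 0 n.
  move=> AA'; rewrite /block /address; apply: eq_map => i /=.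
  rewrite AA'; congr (A' (inl (storage_var (block_pos k l _ _)))).
  by apply: eq_map => j /=.
rewrite (blockE _ (join_assign a b0)); last by move=> v; rewrite !ffunE.
apply/eqP/(@eq_from_nth _ false); rewrite !size_mkseq // => i i_d.
rewrite nth_mkseq // ffunE /guess_var insubT; first by apply: leq_trans i_d _.
move=> i_delta; rewrite ffunE /= !nth_mkseq //.
exact: leq_trans i_d _.
Qed.

End StorageVariables.

(** * Deterministic programs with guessed bits *)

Section StoragePrograms.
Variables (V : finType) (X B : nat -> V) (k : nat).
Local Notation assign := {ffun V -> bool}.
Hypothesis k_gt0 : 0 < k.

Definition guessed_storage l d (A : assign) : nat :=
  (guessed B A d == block X k l A 0 d) * A (X (data_pos k l (block X k l A 0 l))).

(** Per address, [3 * d] pays for the check, [2 ^ n] for the tree over the early block bits and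
    [2 ^ (2 ^ j + j)] for the table lookups. The last term pays for reading a table after each
    prefix of [d + n] bits. *)
Lemma program_guessed_storage d n j : exists L',
  extends true [::]
    (2 ^ k * (3 * d + 2 ^ n + 2 ^ (2 ^ j + j)) + 2 ^ (d + n + 2 ^ j))
    (guessed_storage (d + n + j) d :: L').
Proof.
set l := d + n + j.
have [L1 e1 r1] := @extends_guessed_data V X k l true B d n j [::] (program_nil V true).
have [_ _ pL1] := e1.
have [L2 e2] := @program_storage V X k l true B d n
  (fun u A => A (X (data_pos k l (guessed B A d ++ u ++ block X k l A (d + n) j))))
  L1 k_gt0 pL1 r1.
exists L2.
apply: eq_extends_head (extends_leq _ (extends_trans e1 e2)) => [A|].
  rewrite /guessed_storage; case: eqP => //= ->.
  by rewrite /l !blockD catA.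
 rewrite !expnD !mulnDr.
have := expn_gt0 2 k; have := expn_gt0 2 n; have := expn_gt0 2 d.
have := expn_gt0 2 j; have := expn_gt0 2 (2 ^ j).
set a := 2 ^ k; set b := 2 ^ n; set c := 2 ^ d; set e := 2 ^ 2 ^ j; set g := 2 ^ j.
case: a => // a; case: b => // b; case: c => // c; case: e => // e; case: g => // g.
by move=> _ _ _ _ _ /=; nia.
Qed.

Lemma program_all_guessed l : exists L',
  extends true [::] (2 ^ k * (3 * l + 1) + 2 * 2 ^ l) (guessed_storage l l :: L').
Proof.
(* A single tree reads the whole guess and then the data bit to which it points. *)
pose q w := if size w < l then B (size w) else X (data_pos k l w).
have [w _|L1 e1 r1] := @decision_tree V true l.+1 q
  (fun w _ => nth false w l) [::] (program_nil V true).
  exact: reachable_bool.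
have [_ _ pL1] := e1.
have answersE A : answers l.+1 q A =
    rcons (guessed B A l) (A (X (data_pos k l (guessed B A l)))).
  apply: answersP; first by rewrite size_rcons size_mkseq.
  move=> i; rewrite ltnS => i_l; rewrite /q size_takel ?size_rcons ?size_mkseq ?leqW //.
  rewrite nth_rcons size_mkseq -cats1; case: ltngtP i_l => // [i_l _|-> _].
    by rewrite nth_mkseq.
  by rewrite take_size_cat ?size_mkseq.
have [u|L2 e2] := @program_storage V X k l true B l 0
  (fun _ A => A (X (data_pos k l (guessed B A l)))) L1 k_gt0 pL1.
  move=> _; apply: eq_reachable r1 => A.
  by rewrite answersE nth_rcons size_mkseq ltnn eqxx.
exists L2.
apply: eq_extends_head (extends_leq _ (extends_trans e1 e2)) => [A|].
  by rewrite /guessed_storage; case: eqP => //= ->.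
 rewrite expnS.
have : 0 < 2 ^ k by rewrite expn_gt0.
have : 0 < 2 ^ l by rewrite expn_gt0.
by move=> *; nia.
Qed.

End StoragePrograms.

(** * Choice of the table size *)

Lemma mul_exp2_le x y : 0 < x <= y -> y * 2 ^ x <= x * 2 ^ y.
Proof.
case/andP=> x_gt0 /subnK <-; elim: (y - x) => [//|i IH].
rewrite addSn expnS; have : 2 ^ x <= 2 ^ (i + x) by rewrite leq_exp2l ?leq_addl.
move: IH; nia.
Qed.

(** The quotient [t ^ 2 / 2 ^ t] is largest at [t = 3], where it is 9/8; from there on doubling
    outweighs the growth of the square. *)
Lemma sqr_le_exp2 t : 4 * t ^ 2 <= 5 * 2 ^ t.
Proof.
have [|t_ge3] := ltnP t 3; first by case: t => [|[|[|]]].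
rewrite -(subnK t_ge3); elim: (t - 3) => [//|i].
by rewrite addSn (expnS 2) -!mulnn; set x := 2 ^ _; nia.
Qed.

Lemma table_height m : 0 < m -> exists j, [/\ j <= m, m * 2 ^ (m - j) <= 4 * 2 ^ m,
  m * 2 ^ (2 ^ j + j) <= 5 * 2 ^ m & m * 2 ^ 2 ^ j <= 2 ^ j * 2 ^ m].
Proof.
move=> m_gt0; have [m_le1|m_gt1] := leqP m 1.
  by exists 0; have -> : m = 1 by lia.
have /andP[lo hi] := @trunc_log_bounds 2 m isT m_gt0.
have t_gt0 : 0 < trunc_log 2 m by rewrite trunc_log_gt0.
(* Taking [j] one below the logarithm gives [2 * 2 ^ j <= m < 4 * 2 ^ j]. *)
have [j jE] : exists j, trunc_log 2 m = j.+1 by exists (trunc_log 2 m).-1; rewrite prednK.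
exists j; move: lo hi; rewrite {}jE !expnS.
have j_lt : j < 2 ^ j by rewrite ltn_expl.
have t0 : 0 < 2 ^ j by rewrite expn_gt0.
move=> lo hi; have jm : j <= m by lia.
split=> //.
- have -> : 2 ^ m = 2 ^ (m - j) * 2 ^ j by rewrite -expnD subnK.
  rewrite (mulnCA 4) (mulnC m) leq_mul2l; apply/orP; right.
  by move: hi; rewrite mulnA => /ltnW.
(* The chain is [m * t <= 4 * t ^ 2 <= 5 * 2 ^ t <= 5 * 2 ^ (m - t)], multiplied by [2 ^ t]. *)
- set t := 2 ^ j in lo hi j_lt t0 *.
  have : 2 ^ t <= 2 ^ (m - t) by rewrite leq_exp2l //; lia.
  have := sqr_le_exp2 t; rewrite expnD -/t.
  have -> : 2 ^ m = 2 ^ (m - t) * 2 ^ t by rewrite -expnD subnK //; lia.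
  set u := 2 ^ (m - t); set v := 2 ^ t => H1 H2.
  rewrite (mulnC v) mulnA [leqRHS]mulnA leq_mul2r; apply/orP; right.
  have : m * t <= 4 * t * t by rewrite leq_mul2r; apply/orP; right; lia.
  by rewrite expnS expn1 in H1; move: H1 H2; clear; nia.
- by apply: mul_exp2_le; lia.
Qed.

Import Order.TTheory GRing.Theory Num.Theory.

(** * Real-valued bounds on the size measures *)

Section Measures.
Context (R : realType).
Local Open Scope ring_scope.

Lemma min_size_le (S : set nat) n (r : R) :
  S n -> n%:R <= r -> (min_size S <= r%:E)%E.
Proof.
move=> Sn nr; rewrite /min_size; case: pselect => [S_neq0|[]]; last first.
  by exists n; apply/mem_set.
case: ex_minnP => m _ /(_ n (mem_set Sn)) mn.
by rewrite lee_fin; apply: le_trans nr; rewrite ler_nat.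
Qed.

Lemma powR2_nat n : 2 `^ (n%:R : R) = (2 ^ n)%:R.
Proof. by rewrite powR_mulrn // natrX. Qed.

(** For even [p] both sides agree. For odd [p] the left side is [4 * 2 ^ (k + p./2)], and the claim
    reduces to 4 being at most 3 times the square root of 2, that is, to 16 being at most 18. *)
Lemma sum_half_powers_le k p : (2 ^ (k + uphalf p) + 2 * 2 ^ (k + p./2))%:R <=
  3 * 2 `^ (k%:R + p%:R / 2) :> R.
Proof.
have two_neq0 : (2 : R) != 0 by [].
have half_ge : 4 <= 3 * 2 `^ (2^-1) :> R.
  rewrite powR12_sqrt // -ler_pdivrMl // -[leLHS]gtr0_norm ?divr_gt0 //.
  by rewrite -sqrtr_sqr ler_sqrt //; lra.
have pE : p%:R = (odd p)%:R + (p./2)%:R * 2 :> R.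
  by rewrite -{1}(odd_double_half p) -muln2 natrD natrM.
rewrite uphalf_half pE (mulrDl (odd p)%:R) mulfK // addrCA powRD ?two_neq0 ?implybT //.
rewrite -natrD powR2_nat natrD !natrM (addnCA k) expnD natrM.
set x : R := (2 ^ (k + p./2))%:R.
have x_ge0 : 0 <= x by [].
by case: (odd p); rewrite ?mul0r ?powRr0 ?mul1r /=; nra.
Qed.

Lemma guessed_storage_size k d m : (0 < m)%N -> exists n j, m = (n + j)%N /\
  (2 ^ k * (3 * d + 2 ^ n + 2 ^ (2 ^ j + j)) + 2 ^ (d + n + 2 ^ j))%:R <=
  (2 ^ k)%:R * (3 * d%:R + 9 * ((2 ^ m)%:R / m%:R)) + (2 ^ (m + (d + m)))%:R / m%:R :> R.
Proof.
move=> m_gt0; have [j [jm le_tree le_table le_data]] := table_height m_gt0.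
have m_gt0' : 0 < m%:R :> R by rewrite ltr0n.
exists (m - j)%N, j; split; first by rewrite subnK.
rewrite natrD; apply: lerD; last first.
  (* The factor [2 ^ j] from [le_data] completes [2 ^ (m - j)] to [2 ^ m]. *)
  rewrite ler_pdivlMr // -natrM ler_nat !expnD mulnC.
  have -> : (2 ^ m * (2 ^ d * 2 ^ m) = 2 ^ d * 2 ^ (m - j) * (2 ^ j * 2 ^ m))%N.
    by rewrite -{1}(subnK jm) expnD; lia.
  by rewrite mulnCA leq_mul2l le_data orbT.
rewrite natrM ler_wpM2l ?ler0n // (natrD _ (3 * d + _)) (natrD _ (3 * d)).
rewrite (natrM _ 3) -addrA lerD2l.
(* The tree over the early block bits contributes 4 and the table lookups contribute 5. *)
rewrite (_ : 9 = 4 + 5 :> R); last by ring.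
by rewrite mulrDl lerD // mulrA ler_pdivlMr // -natrM mulnC -natrM ler_nat.
Qed.

Lemma LNBP_ISA_le k l delta d N L' (r : R) : (d <= delta)%N -> (d <= l)%N ->
  extends true [::] N (@guessed_storage _ (inl \o storage_var k l)
    (@guess_var k l delta) k l d :: L') ->
  N%:R <= r -> (LNBP delta (@ISA k l) <= r%:E)%E.
Proof.
move=> d_delta d_l [_ sL pL] N_r.
have [P [detP nbpP _ sP]] := program_bp pL.
apply: (@min_size_le _ (bp_size P)); last first.
  by apply: le_trans N_r; rewrite ler_nat sP; move: sL; rewrite /= addn0.
exists P; split=> //; first exact: detP.
apply: (guess_storage d_delta d_l) => A.
by rewrite nbpP /guessed_storage muln_gt0 !lt0b.
Qed.

End Measures.

Local Open Scope ring_scope.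

Theorem theorem5p1 (R : realType) (delta : nat) (k l : nat)
    (hk : (0 < k)%N) (hl : (0 < l)%N) :
  let f := @ISA k l in
  let K : R := k%:R in
  let L : R := l%:R in
  let D : R := delta%:R in
  [/\ (NBP f <= (3 * 2 `^ (K + L / 2) + 2 `^ L)%:E)%E /\
      (parityBP f <= (3 * 2 `^ (K + L / 2) + 2 `^ L)%:E)%E,
      ((delta < l)%N ->
         (LNBP delta f <=
           (12 * 2 `^ K * Num.max (2 `^ (L - D) / (L - D)) L
            + 2 `^ (2 * L - D) / (L - D))%:E)%E) /\
      ((l <= delta)%N ->
         (LNBP delta f <= (2 `^ K * (3 * L + 1) + 2 * 2 `^ L)%:E)%E),
      (BP f <= (9 * (2 `^ (K + L) / L) + 2 `^ (2 * L) / L)%:E)%E,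
      (LNBF delta f <=
         (12 * 2 `^ K * Num.max (2 `^ (L - D)) L + 3 * 2 `^ L)%:E)%E &
      (BF f <= (7 * 2 `^ K * 2 `^ L)%:E)%E].
Proof.
move=> f K L D.
have ISA_data (a : {ffun 'I_(ISA_len k l) -> bool}) :
    a (storage_var k l (data_pos k l (block (storage_var k l) k l a 0 l))) = f a.
  by apply: ISA_storage => p; exact: storage_varE.
have L_gt0 : 0 < L by rewrite ltr0n.
split.
- have l_split : (uphalf l + l./2)%N = l.
    by rewrite uphalf_half -addnA addnn odd_double_half.
  (* The longer half of the block is read forward, since a reverse tree costs about twice as much as
     a forward tree of the same depth. *)
  have [|L' [_ sL pL]] :=
    @program_unambiguous _ (storage_var k l) k l (uphalf l) l./2.
    by rewrite ltn_addr.
  have [P [_ nbpP parP sP]] := program_bp pL.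
  have bound : (bp_size P)%:R <= 3 * 2 `^ (K + L / 2) + 2 `^ L :> R.
    apply: le_trans (lerD (sum_half_powers_le R k l) (lexx _)).
    rewrite powR2_nat -natrD ler_nat sP; move: sL; rewrite /= addn0.
    by rewrite l_split expnS; lia.
  rewrite l_split in nbpP parP.
  split; apply: min_size_le bound; exists P; split=> // a.
    by rewrite nbpP ISA_data; case: (f a).
  by rewrite parP ISA_data; case: (f a).
- split=> [d_l|l_d].
    have m_gt0 : (0 < l - delta)%N by rewrite subn_gt0.
    have [n [j [mE size_le]]] := guessed_storage_size R k delta m_gt0.
    have lE : (delta + n + j)%N = l by rewrite -addnA -mE subnKC // ltnW.
    have [L' eL'] := @program_guessed_storage _ (inl \o storage_var k l)
      (@guess_var k l delta) k hk delta n j.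
    rewrite lE in eL'; apply: LNBP_ISA_le (leqnn _) (ltnW d_l) eL' _.
    apply: le_trans size_le _.
    have -> : L - D = (l - delta)%:R by rewrite natrB // ltnW.
    have -> : 2 * L - D = (l - delta + (delta + (l - delta)))%:R.
      by rewrite subnKC ?natrD ?natrB ?(ltnW d_l) //; rewrite /L /D; ring.
    rewrite !powR2_nat lerD2r (mulrC 12) -(mulrA _ 12) ler_wpM2l ?ler0n //.
    set q := _ / _; set M := Num.max q L.
    have qM : q <= M by rewrite le_max lexx.
    have LM : L <= M by rewrite le_max lexx orbT.
    have DL : D <= L by rewrite ler_nat ltnW.
    (* The claim is [3 * D + 9 * q <= 12 * M], where both [D] and [q] are at most [M]. *)
    by rewrite -/D; lra.
  have [L' eL'] := @program_all_guessed _ (inl \o storage_var k l)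
    (@guess_var k l delta) k hk l.
  apply: LNBP_ISA_le l_d (leqnn _) eL' _.
  by rewrite !powR2_nat (natrD _ (_ * _)) !natrM (natrD _ (3 * _)) natrM.
(* The deterministic bound is the case [d = 0], where the check compares two empty words. *)
- have [n [j [mE size_le]]] := guessed_storage_size R k 0 hl.
  have [L' [_ sL pL]] := @program_guessed_storage _ (storage_var k l)
    (storage_var k l) k hk 0 n j.
  have [P [detP nbpP _ sP]] := program_bp pL.
  apply: (@min_size_le _ _ (bp_size P)).
    exists P; split=> // [|a]; first exact: detP.
    by rewrite nbpP /guessed_storage add0n -mE ISA_data; case: (f a).
  have PN : (bp_size P)%:R <= (2 ^ k * (3 * 0 + 2 ^ n + 2 ^ (2 ^ j + j))
      + 2 ^ (0 + n + 2 ^ j))%:R :> R.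
    by rewrite ler_nat sP; move: sL; rewrite /= addn0.
  apply: le_trans (le_trans PN size_le) _.
  rewrite -natrD -(natrM R 2 l) !powR2_nat mulr0 add0r add0n addnn -mul2n.
  by rewrite lerD2r expnD natrM mulrCA -mulrA.
(* The block has only [l] bits to guess; for [l <= delta] the multiplexer over block bits has no
   selectors left. *)
- pose d := minn delta l.
  have d_delta : (d <= delta)%N by rewrite geq_minl.
  have d_l : (d <= l)%N by rewrite geq_minr.
  pose phi := storage_formula (inl \o storage_var k l) k l (@guess_var k l delta) d (l - d).
  apply: (@min_size_le _ _ (bf_size phi)).
    exists phi; split=> //; apply: (guess_storage d_delta d_l) => A.
    by rewrite storage_formula_fun subnKC.
  set M := Num.max _ _.
  have LM : L <= M by rewrite le_max lexx orbT.
  have dM : d%:R <= M by apply: le_trans LM; rewrite ler_nat.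
  have nM : (2 ^ (l - d)).-1%:R <= M.
    have [l_d|d_lt] := leqP l delta.
      by rewrite /d (minn_idPr l_d) subnn /=; apply: le_trans LM.
    rewrite /d (minn_idPl (ltnW d_lt)) le_max -natrB ?(ltnW d_lt) // powR2_nat ler_nat.
    by rewrite leq_pred.
  have size_le : (bf_size phi <= 2 ^ k * (3 * d + 6 * (2 ^ (l - d)).-1) + 3 * 2 ^ l)%N.
    apply: leq_trans (storage_formula_size _ _ _ _ _ _) _.
    rewrite -{4}(subnK d_l) expnD.
    by nia.
  apply: le_trans (_ : _ <= (2 ^ k * (3 * d + 6 * (2 ^ (l - d)).-1) + 3 * 2 ^ l)%:R) _.
    by rewrite ler_nat.
  rewrite !powR2_nat (natrD _ (_ * _)) !natrM (natrD _ (3 * _)) !natrM lerD2r.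
  rewrite (mulrC 12) -mulrA.
  (* By [dM] and [nM] the left factor is at most [9 * M]. *)
  by rewrite ler_wpM2l ?ler0n //; lra.
(* Without guesses the size is at most [6 * 2 ^ k * (2 ^ l - 1) + 2 ^ l]. *)
- pose phi := storage_formula (storage_var k l) k l (storage_var k l) 0 l.
  apply: (@min_size_le _ _ (bf_size phi)).
    exists phi; split=> // a.
    by rewrite storage_formula_fun ISA_data.
  rewrite !powR2_nat -!natrM ler_nat; apply: leq_trans (storage_formula_size _ _ _ _ _ _) _.
  have : (0 < 2 ^ l)%N by rewrite expn_gt0.
  have : (0 < 2 ^ k)%N by rewrite expn_gt0.
  rewrite mul0n !add0n expn0; move: (2 ^ l)%N (2 ^ k)%N => [//|x] [//|y] _ _.
  by rewrite /=; nia.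
Qed.
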